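(* Let $\mathcal{C}$ be an additive category with cokernels and let $F\in\mathrm{mod}(\mathcal{C})$. Then the following are equivalent: (i) $F\in\underline{\mathrm{mod}}(\mathcal{C})$; (ii) there exists an epimorphism $A_2\to A_1$ in $\mathcal{C}$ such that the induced sequence $\mathrm{Hom}_{\mathcal{C}}(-,A_2)\to\mathrm{Hom}_{\mathcal{C}}(-,A_1)\to F\to 0$ is exact; (iii) $\mathrm{Hom}_{\mathrm{mod}(\mathcal{C})}(F,G)=0$ for every $G\in\mathrm{mod}(\mathcal{C})$ which sends epimorphisms of $\mathcal{C}$ to monomorphisms of abelian groups.
   Context: $\mathcal{C}$ is a small category (relative to a fixed universe). $\mathrm{Mod}(\mathcal{C})$ is the category of additive functors $\mathcal{C}^{\mathrm{op}}\to\mathrm{Ab}$. A functor $F\in\mathrm{Mod}(\mathcal{C})$ is coherent if there is an exact sequence $\mathrm{Hom}_{\mathcal{C}}(-,A)\to\mathrm{Hom}_{\mathcal{C}}(-,B)\to F\to 0$ (a presentation of $F$) with $A,B\in\mathcal{C}$; $\mathrm{mod}(\mathcal{C})$ is the full subcategory of coherent functors. When $\mathcal{C}$ has cokernels, the Yoneda functor $h_{\mathcal{C}}:\mathcal{C}\to\mathrm{mod}(\mathcal{C})$, $A\mapsto\mathrm{Hom}_{\mathcal{C}}(-,A)$, has a left adjoint $v:\mathrm{mod}(\mathcal{C})\to\mathcal{C}$, given by $v(F)=\mathrm{Coker}(X\to Y)$ for a presentation $\mathrm{Hom}_{\mathcal{C}}(-,X)\to\mathrm{Hom}_{\mathcal{C}}(-,Y)\to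 F\to 0$. $\underline{\mathrm{mod}}(\mathcal{C})$ is the full subcategory of those $F\in\mathrm{mod}(\mathcal{C})$ with $v(F)=0$. *)

(* Defs.v *)
From HB Require Import structures.
From mathcomp Require Import all_boot all_algebra.
From mathcomp Require Import boolp.

Set Implicit Arguments.
Unset Strict Implicit.
Unset Printing Implicit Defensive.

Import GRing.Theory.
Local Open Scope ring_scope.

(* Abelian groups are zmodTypes.  The eqType and choiceType structures that a
   zmodType carries exist on every type, by classical logic (boolp). *)

Reserved Notation "g \oc f" (at level 40, left associativity).

Record preadditive := Preadditive {
  ob :> Type;
  Mor : ob -> ob -> zmodType;
  idm : forall A, Mor A A;
  compm : forall A B D, Mor B D -> Mor A B -> Mor A D;
  comp1m : forall A B (f : Mor A B), compm (idm B) f = f;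
  compm1 : forall A B (f : Mor A B), compm f (idm A) = f;
  compmA : forall A B D E (h : Mor D E) (g : Mor B D) (f : Mor A B),
    compm h (compm g f) = compm (compm h g) f;
  compDl : forall A B D (g g' : Mor B D) (f : Mor A B),
    compm (g + g') f = compm g f + compm g' f;
  compDr : forall A B D (g : Mor B D) (f f' : Mor A B),
    compm g (f + f') = compm g f + compm g f' }.

Arguments idm {p} A.
Notation "g \oc f" := (compm g f).

Section Category.
Variable C : preadditive.
Implicit Types A B X Y Z W : C.

Lemma comp0m A B Z (f : Mor A B) : (0 : Mor B Z) \oc f = 0.
Proof. by apply: (addrI ((0 : Mor B Z) \oc f)); rewrite -compDl !addr0. Qed.

Lemma compm0 A B Z (g : Mor B Z) : g \oc (0 : Mor A B) = 0.
Proof. by apply: (addrI (g \oc (0 : Mor A B))); rewrite -compDr !addr0. Qed.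

(* Existence of the morphisms is automatic: Mor X Y contains 0. *)
Definition is_zero_object Z : Prop :=
  (forall X (f g : Mor Z X), f = g) /\ (forall X (f g : Mor X Z), f = g).

Definition is_biproduct X Y W (i1 : Mor X W) (i2 : Mor Y W)
    (p1 : Mor W X) (p2 : Mor W Y) : Prop :=
  [/\ p1 \oc i1 = idm X, p2 \oc i2 = idm Y, p1 \oc i2 = 0, p2 \oc i1 = 0
    & i1 \oc p1 + i2 \oc p2 = idm W].

Definition is_additive : Prop :=
  (exists Z, is_zero_object Z) /\
  (forall X Y, exists W (i1 : Mor X W) (i2 : Mor Y W)
     (p1 : Mor W X) (p2 : Mor W Y), is_biproduct i1 i2 p1 p2).

Definition is_epi X Y (f : Mor X Y) : Prop :=
  forall Z (g h : Mor Y Z), g \oc f = h \oc f -> g = h.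

Definition is_cokernel X Y (f : Mor X Y) Z (c : Mor Y Z) : Prop :=
  c \oc f = 0 /\
  forall W (g : Mor Y W), g \oc f = 0 -> exists! h : Mor Z W, h \oc c = g.

Record cokernel X Y (f : Mor X Y) := Cokernel {
  coker_ob : C;
  coker_map : Mor Y coker_ob;
  cokerP : is_cokernel f coker_map }.

Definition has_cokernels : Prop :=
  forall X Y (f : Mor X Y), inhabited (cokernel f).

(* Objects of Mod(C): contravariant additive functors from C to abelian
   groups. *)
Record Mod := MkMod {
  Mob :> C -> zmodType;
  Mmap : forall X Y, Mor X Y -> {additive Mob Y -> Mob X};
  Mmap1 : forall X (x : Mob X), Mmap (idm X) x = x;
  MmapM : forall X Y Z (g : Mor Y Z) (f : Mor X Y) (x : Mob Z),
    Mmap (g \oc f) x = Mmap f (Mmap g x);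
  MmapD : forall X Y (f g : Mor X Y) (x : Mob Y),
    Mmap (f + g) x = Mmap f x + Mmap g x }.

Record nattrans (F G : Mod) := Nattrans {
  ntmap :> forall X, {additive F X -> G X};
  ntmapN : forall X Y (f : Mor X Y) (x : F Y),
    ntmap X (Mmap F f x) = Mmap G f (ntmap Y x) }.

Lemma nattrans_ext (F G : Mod) (a b : nattrans F G) :
  (forall X (x : F X), a X x = b X x) -> a = b.
Proof.
case: a b => [a aN] [b bN] /= ab.
have e : a = b.
  apply: functional_extensionality_dep => X; move: (ab X).
  case: (a X) (b X) => [u [[um]]] [w [[wm]]] /= /funext uw.
  by case: _ / uw wm => wm; rewrite (Prop_irrelevance wm um).
by case: _ / e bN => bN; congr Nattrans; apply: Prop_irrelevance.
Qed.

Section NatZero.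
Variables F G : Mod.

Let nt0 X : {additive F X -> G X} := \0.

Fact nt0N X Y (f : Mor X Y) (x : F Y) :
  nt0 X (Mmap F f x) = Mmap G f (nt0 Y x).
Proof. by rewrite /= raddf0. Qed.

Definition ntzero : nattrans F G := Nattrans nt0N.
End NatZero.

Section Precomposition.
Variables (W X Y : C) (f : Mor X Y).

Definition precomp (g : Mor Y W) : Mor X W := g \oc f.

Fact precomp_is_nmod_morphism : nmod_morphism precomp.
Proof. by split=> [|g h]; rewrite /precomp ?comp0m ?compDl. Qed.

HB.instance Definition _ :=
  GRing.isNmodMorphism.Build (Mor Y W) (Mor X W) precomp
    precomp_is_nmod_morphism.
End Precomposition.

Section Postcomposition.
Variables (W X Y : C) (f : Mor X Y).

Definition postcomp (g : Mor W X) : Mor W Y := f \oc g.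

Fact postcomp_is_nmod_morphism : nmod_morphism postcomp.
Proof. by split=> [|g h]; rewrite /postcomp ?compm0 ?compDr. Qed.

HB.instance Definition _ :=
  GRing.isNmodMorphism.Build (Mor W X) (Mor W Y) postcomp
    postcomp_is_nmod_morphism.
End Postcomposition.

Section Yoneda.
Variable A : C.

Let ymap X Y (f : Mor X Y) : {additive Mor Y A -> Mor X A} := @precomp A X Y f.

Fact ymap1 X (x : Mor X A) : ymap (idm X) x = x.
Proof. exact: compm1. Qed.

Fact ymapM X Y Z (g : Mor Y Z) (f : Mor X Y) (x : Mor Z A) :
  ymap (g \oc f) x = ymap f (ymap g x).
Proof. exact: compmA. Qed.

Fact ymapD X Y (f g : Mor X Y) (x : Mor Y A) :
  ymap (f + g) x = ymap f x + ymap g x.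
Proof. exact: compDr. Qed.

Definition yoneda : Mod := MkMod ymap1 ymapM ymapD.
End Yoneda.

Section YonedaMap.
Variables (A B : C) (f : Mor A B).

Let ypost X : {additive yoneda A X -> yoneda B X} := @postcomp X A B f.

Fact ypostN X Y (g : Mor X Y) (x : yoneda A Y) :
  ypost X (Mmap (yoneda A) g x) = Mmap (yoneda B) g (ypost Y x).
Proof. exact: compmA. Qed.

Definition yoneda_map : nattrans (yoneda A) (yoneda B) := Nattrans ypostN.
End YonedaMap.

(* Kernels, images and zero objects in Mod(C) are computed pointwise. *)
Definition exact_right (F G H : Mod) (a : nattrans F G) (b : nattrans G H)
    : Prop :=
  (forall X (y : G X), b X y = 0 <-> exists x : F X, a X x = y) /\
  (forall X (z : H X), exists y : G X, b X y = z).

Record presentation (F : Mod) := Presentation {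
  pres_src : C;
  pres_tgt : C;
  pres_map : Mor pres_src pres_tgt;
  pres_proj : nattrans (yoneda pres_tgt) F;
  presP : exact_right (yoneda_map pres_map) pres_proj }.

Definition coherent (F : Mod) : Prop := inhabited (presentation F).

(* Objects of mod(C), a full subcategory of Mod(C): the morphisms from F to G
   are [nattrans F G]. *)
Record cohMod := CohMod {
  coh_val :> Mod;
  cohP : coherent coh_val }.

Definition epi_to_mono (G : Mod) : Prop :=
  forall X Y (f : Mor X Y), is_epi f -> injective (Mmap G f).

Section LeftAdjoint.
Hypothesis hK : has_cokernels.
Variable F : cohMod.

Definition chosen_pres : presentation F := inhabited_witness (cohP F).

Definition chosen_coker : cokernel (pres_map chosen_pres) :=
  inhabited_witness (hK (pres_map chosen_pres)).

(* v(F): the cokernel of a presentation of F, both selected by choice. *)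
Definition v_ob : C := coker_ob chosen_coker.

(* v(F) carries a universal arrow from F to the Yoneda functor; hence v_ob is
   the object part of the left adjoint of the Yoneda functor, and up to isomorphism
   does not depend on the choices. *)
Lemma v_universal :
  exists eta : nattrans F (yoneda v_ob),
  forall W (a : nattrans F (yoneda W)),
  exists! h : Mor v_ob W, forall X (x : F X), yoneda_map h X (eta X x) = a X x.
Proof.
rewrite /v_ob; case: chosen_coker => V c [cf0 cU] /=.
move: chosen_pres c cf0 cU => [A B f p [/= ex sur]] /= c cf0 cU.
pose lft X (x : F X) : Mor X B := projT1 (cid (sur X x)).
have lftK X (x : F X) : p X (lft X x) = x by rewrite /lft; case: cid.
have kill Z (g : Mor B Z) X (y y' : Mor X B) :
    g \oc f = 0 -> p X y = p X y' -> g \oc y = g \oc y'.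
  move=> gf0 yy'; apply/eqP; rewrite -subr_eq0; apply/eqP.
  have /ex[t tE] : p X (y - y') = 0 by rewrite raddfB yy' subrr.
  have -> : g \oc y - g \oc y' = g \oc (y - y').
    by rewrite -[LHS]/(postcomp g y - postcomp g y') -raddfB.
  by rewrite -tE /= /postcomp compmA gf0 comp0m.
pose e X (x : F X) : Mor X V := c \oc lft X x.
have eE X (y : Mor X B) : e X (p X y) = c \oc y by apply: kill.
have eadd X : nmod_morphism (e X).
  split=> [|x y]; first by rewrite -(raddf0 (p X)) eE compm0.
  by rewrite -{1}(lftK X x) -{1}(lftK X y) -raddfD eE compDr.
pose ea X : {additive F X -> yoneda V X} := HB.pack (e X)
  (GRing.isNmodMorphism.Build (F X) (yoneda V X) (e X) (eadd X)).
have eN X Y (g : Mor X Y) (x : F Y) :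
    ea X (Mmap F g x) = Mmap (yoneda V) g (ea Y x).
  rewrite -{1}(lftK Y x) -ntmapN /=.
  by rewrite [LHS]eE /= /precomp /e compmA.
exists (Nattrans eN) => W a.
have pE X (y : Mor X B) : p X y = Mmap F y (p B (idm B)).
  by rewrite -ntmapN /= /precomp comp1m.
have aE X (y : Mor X B) : a X (p X y) = a B (p B (idm B)) \oc y.
  by rewrite pE ntmapN.
have gf0 : a B (p B (idm B)) \oc f = 0.
  rewrite -aE; have -> : p A f = 0; last by rewrite raddf0.
  by apply/ex; exists (idm A); rewrite /= /postcomp compm1.
have [h [hE hU]] := cU _ _ gf0.
exists h; split=> [X x | h' h'E].
  by rewrite /= /postcomp /e compmA hE -aE lftK.
apply: hU; rewrite -h'E /= /postcomp.
by rewrite eE compm1.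
Qed.

Definition in_umod : Prop := is_zero_object v_ob.

End LeftAdjoint.
End Category.

(* Main.v *)
Require Import Defs.
From mathcomp Require Import all_boot.
From mathcomp Require Import all_algebra.

(** The equivalence rests on two facts.  In a category with cokernels, a
    morphism is an epimorphism as soon as its cokernel is zero; so if
    v(F), the cokernel of a presentation of F, vanishes, then the presenting
    morphism is an epimorphism.  And by Yoneda a morphism a : F -> G, where
    p : Hom(-, A1) -> F is the projection of a presentation by
    f : A2 -> A1, is determined by the element a(p(id)) of G(A1), which G(f)
    kills; if f is an epimorphism and G sends epimorphisms to monomorphisms,
    this element is 0 ([nattrans_epi_presented_eq0]).

    To come back to v(F) = 0, take as test functor G the representable
    Hom(-, v(F)).  It is coherent and sends epimorphisms to monomorphisms, so
    the universal arrow F -> Hom(-, v(F)) is zero; since every morphism out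
    of v(F) is determined by its composite with this arrow, v(F) has only one
    morphism to any object, and is zero. *)

Set Implicit Arguments.
Unset Strict Implicit.
Unset Printing Implicit Defensive.

Import GRing.Theory.
Local Open Scope ring_scope.

Section Coherent.
Variable C : preadditive.

Lemma compBl (X Y Z : C) (g h : Mor Y Z) (f : Mor X Y) :
  (g - h) \oc f = g \oc f - h \oc f.
Proof. exact: (raddfB (@precomp C Z X Y f)). Qed.

Lemma zero_objectP (Z : C) : is_zero_object Z <-> idm Z = 0.
Proof.
split=> [[from_Z _] | id0]; first exact: from_Z.
split=> X f g.
  by rewrite -(compm1 f) -(compm1 g) id0 !compm0.
by rewrite -(comp1m f) -(comp1m g) id0 !comp0m.
Qed.

(** The difference of two morphisms that agree after [f] factors through the
    cokernel of [f], hence through zero. *)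
Lemma epi_of_zero_cokernel (X Y V : C) (f : Mor X Y) (c : Mor Y V) :
  is_cokernel f c -> is_zero_object V -> is_epi f.
Proof.
move=> [_ cU] [from_V _] Z g h gfhf.
have ghf0 : (g - h) \oc f = 0 by rewrite compBl gfhf subrr.
have [k [kc _]] := cU _ _ ghf0.
by apply/eqP; rewrite -subr_eq0 -kc (from_V _ k 0) comp0m.
Qed.

Lemma yoneda_coherent (A : C) : coherent (yoneda A).
Proof.
(* The presentation is Hom(-, A) -> Hom(-, A) -> Hom(-, A), zero followed by
   the identity. *)
have ex : exact_right (yoneda_map (0 : Mor A A)) (yoneda_map (idm A)).
  split=> X y; last by exists y; exact: comp1m.
  rewrite /= /postcomp comp1m; split=> [-> | [x <-]]; last exact: comp0m.
  by exists 0; rewrite comp0m.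
exact: inhabits (Presentation ex).
Qed.

(** Hom(-, A) sends an epimorphism to precomposition by it, which is injective
    by the very definition of an epimorphism. *)
Lemma yoneda_epi_to_mono (A : C) : epi_to_mono (yoneda A).
Proof. by move=> X Y f epi_f g h; apply: epi_f. Qed.

(** Yoneda: a morphism out of Hom(-, A) is evaluation at its value on the
    identity of A. *)
Lemma nattrans_yonedaE (A : C) (G : Mod C) (b : nattrans (yoneda A) G)
    (X : C) (y : Mor X A) :
  b X y = Mmap G y (b A (idm A)).
Proof. by rewrite -ntmapN /= /precomp comp1m. Qed.

Lemma nattrans_epi_presented_eq0 (F G : Mod C) (A2 A1 : C) (f : Mor A2 A1)
    (p : nattrans (yoneda A1) F) (a : nattrans F G) :
  is_epi f -> exact_right (yoneda_map f) p -> epi_to_mono G ->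
  a = ntzero F G.
Proof.
move=> epi_f [ex sur] monoG.
have pf0 : p A2 f = 0 by apply/ex; exists (idm A2); exact: compm1.
have gen0 : a A1 (p A1 (idm A1)) = 0.
  apply: (monoG _ _ f epi_f).
  by rewrite -ntmapN -nattrans_yonedaE pf0 !raddf0.
apply: nattrans_ext => X x; have [y <-] := sur X x.
by rewrite nattrans_yonedaE ntmapN gen0 raddf0.
Qed.

(** A vanishing universal arrow F -> Hom(-, v(F)) does not distinguish the
    identity of v(F) from 0. *)
Lemma in_umod_of_hom_eq0 (hK : has_cokernels C) (F : cohMod C) :
  (forall a : nattrans F (yoneda (v_ob hK F)), a = ntzero F _) ->
  in_umod hK F.
Proof.
move=> hom0; have [eta eta_univ] := v_universal hK F.
have [h [_ h_uniq]] := eta_univ _ (ntzero F (yoneda (v_ob hK F))).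
have uniq k : h = k.
  by apply: h_uniq => X x; rewrite (hom0 eta) /= /postcomp compm0.
by apply/zero_objectP; rewrite -(uniq (idm _)); exact: uniq.
Qed.

End Coherent.

Theorem proposition2p1 (C : preadditive) (hA : is_additive C)
    (hK : has_cokernels C) (F : cohMod C) :
  [<-> in_umod hK F;
       exists (A2 A1 : C) (f : Mor A2 A1),
         is_epi f /\
         exists p : nattrans (yoneda A1) F, exact_right (yoneda_map f) p;
       forall G : cohMod C, epi_to_mono G ->
         forall a : nattrans F G, a = ntzero F G].
Proof.
tfae.
- move=> v0; exists (pres_src (chosen_pres F)), (pres_tgt (chosen_pres F)).
  exists (pres_map (chosen_pres F)); split.
    exact: epi_of_zero_cokernel (cokerP (chosen_coker hK F)) v0.
  by exists (pres_proj (chosen_pres F)); exact: presP.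
- move=> [A2 [A1 [f [epi_f [p ex]]]]] G monoG a.
  exact: nattrans_epi_presented_eq0 epi_f ex monoG.
- move=> hom0; apply: in_umod_of_hom_eq0 => a.
  exact: (hom0 (CohMod (yoneda_coherent _)) (@yoneda_epi_to_mono _ _)).
Qed.
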